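(* Let $p\in(1,\infty)$ and $\alpha\in(0,1]$ with $(p,\alpha)\neq(2,1)$. Define $$w_{p,\alpha}(x):=\frac{1}{a_p+1}\frac{\Delta x^{\alpha a_p}}{x^{\alpha a_p}}+\frac{a_p}{a_p+1}\frac{\Delta x^{\alpha}}{x^{\alpha}},\qquad x\in\mathbb N .$$ Then for every $u:\mathbb N_0\to\mathbb R$ with $u(0)=0$ and $u\in\ell^p(\mathbb N,x^{-2})$, $$\mathcal E_p^{\mathbb N_0}(u)\geq\sum_{x\in\mathbb N}w_{p,\alpha}(x)|u(x)|^p .$$ The Hardy weight $w_{p,\alpha}$ is strictly positive on $\mathbb N$. Moreover, $w_{p,\alpha}$ is critical whenever $\alpha\leq\frac{1}{a_p+1}$.
   Context: $\mathbb N=\{1,2,\ldots\}$, $\mathbb N_0=\{0,1,2,\ldots\}$. For $p\in(1,\infty)$, $p'=p/(p-1)$ and $a_p:=\min\{p-1,p'-1\}$ (so $a_p=p-1$ if $1<p\le 2$ and $a_p=p'-1=1/(p-1)$ if $p\ge2$). For $a\in\mathbb R$ and $\beta>0$, $a^{\langle\beta\rangle}:=|a|^\beta\operatorname{sgn}a$. For $u:\mathbb N_0\to\mathbb R$ with $u(0)=0$, the discrete Dirichlet Laplacian is $\Delta u(x):=2u(x)-u(x-1)-u(x+1)$, $x\in\mathbb N$; for $\gamma>0$, $\Delta x^\gamma$ denotes $\Delta$ applied to the function $x\mapsto x^\gamma$ on $\mathbb N_0$ (with value $0$ at $0$), evaluated at $x$, i.e. $\Delta x^\gamma=2x^\gamma-(x-1)^\gamma-(x+1)^\gamma$.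 For $u:\mathbb N_0\to\mathbb R$ with $u(0)=0$, the Sobolev--Bregman form is $$\mathcal E_p^{\mathbb N_0}(u):=\sum_{x\in\mathbb N}\bigl(u(x)-u(x-1)\bigr)\bigl(u(x)^{\langle p-1\rangle}-u(x-1)^{\langle p-1\rangle}\bigr)\in[0,\infty].$$ $u\in\ell^p(\mathbb N,x^{-2})$ means $\sum_{x\in\mathbb N}|u(x)|^px^{-2}<\infty$. A Hardy weight for $\mathcal E_p^{\mathbb N_0}$ on $\mathbb N$ is a function $w:\mathbb N\to[0,\infty)$ such that $\mathcal E_p^{\mathbb N_0}(u)\ge\sum_{x\in\mathbb N}w(x)|u(x)|^p$ for all finitely supported $u:\mathbb N_0\to\mathbb R$ with $u(0)=0$. A Hardy weight $w$ is critical if every Hardy weight $\widetilde w$ with $\widetilde w(x)\ge w(x)$ for all $x\in\mathbb N$ coincides with $w$. *)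

(* Defs.v *)
From mathcomp Require Import all_boot all_order all_algebra.
From mathcomp Require Import all_classical all_reals all_analysis.

Set Implicit Arguments.
Unset Strict Implicit.
Unset Printing Implicit Defensive.

Import Order.TTheory GRing.Theory Num.Theory.
Local Open Scope classical_set_scope.
Local Open Scope ring_scope.

(* Functions on the positive integers (weights) are represented by functions
   on nat whose value at 0 is irrelevant: every sum and every quantifier below
   ranges over 1 <= x only. *)

Definition conj_exp (R : realType) (p : R) : R := p / (p - 1).

Definition a_ (R : realType) (p : R) : R := Num.min (p - 1) (conj_exp p - 1).

Definition spow (R : realType) (a b : R) : R := `|a| `^ b * Num.sg a.

Definition dlaplacian (R : realType) (u : nat -> R) (x : nat) : R :=
  2 * u x - u x.-1 - u x.+1.

(* For g > 0 this vanishes at 0, as powR sends 0 to 0 for nonzero exponents. *)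
Definition power_fun (R : realType) (g : R) (x : nat) : R := x%:R `^ g.

(* The terms are nonnegative, so the series always converges in \bar R. *)
Definition sobolev_bregman (R : realType) (p : R) (u : nat -> R) : \bar R :=
  (\sum_(1 <= x <oo)
     ((u x - u x.-1) * (spow (u x) (p - 1) - spow (u x.-1) (p - 1)))%:E)%E.

Definition weighted_sum (R : realType) (p : R) (w u : nat -> R) : \bar R :=
  (\sum_(1 <= x <oo) (w x * `|u x| `^ p)%:E)%E.

Definition in_lp_weight (R : realType) (p : R) (w u : nat -> R) : Prop :=
  (weighted_sum p w u < +oo)%E.

Definition finitely_supported (R : realType) (u : nat -> R) : Prop :=
  finite_set [set x | u x != 0].

Definition hardy_weight (R : realType) (p : R) (w : nat -> R) : Prop :=
  (forall x : nat, (0 < x)%N -> 0 <= w x) /\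
  (forall u : nat -> R, u 0%N = 0 -> finitely_supported u ->
     (weighted_sum p w u <= sobolev_bregman p u)%E).

Definition critical_hardy_weight (R : realType) (p : R) (w : nat -> R) : Prop :=
  hardy_weight p w /\
  (forall w' : nat -> R, hardy_weight p w' ->
     (forall x : nat, (0 < x)%N -> w x <= w' x) ->
     forall x : nat, (0 < x)%N -> w' x = w x).

Definition w_ (R : realType) (p alpha : R) (x : nat) : R :=
  1 / (a_ p + 1) *
    (dlaplacian (power_fun (alpha * a_ p)) x / power_fun (alpha * a_ p) x) +
  a_ p / (a_ p + 1) *
    (dlaplacian (power_fun alpha) x / power_fun alpha x).

(* Main.v *)
Require Import Defs.
From mathcomp Require Import all_boot all_order all_algebra.
From mathcomp Require Import all_classical all_reals all_analysis.
From mathcomp Require Import ring lra.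

Import Order.TTheory GRing.Theory Num.Theory.
Local Open Scope classical_set_scope.
Local Open Scope ring_scope.

(** The weight comes from a ground state representation.  For a function g that
    is positive off the origin, put
      W_g = (1/p) (Lap g^(p-1)) / g^(p-1) + (1 - 1/p) (Lap g) / g.
    With g(n) = n^b, where b = alpha for p <= 2 and b = alpha * a_p for p >= 2,
    the pair {b, b(p-1)} is {alpha, alpha * a_p} and W_g is w_(p,alpha)
    (w_ground_state); in both cases b p = alpha (a_p + 1).

    Write u = g phi.  Summation by parts (ground_state_split) expresses the form
    minus the weighted sum as a sum of edge gaps.  On an edge with values x, y of
    g and s, t of phi the gap is (edge_gapE)
      x y^(p-1) D(s,t) + x^(p-1) y D(t,s),
      D(s,t) = s^p/p + (1 - 1/p) t^p - s t^(p-1),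
    and D >= 0 is Young's inequality.  Replacing u by |u| lowers the edge energy,
    so gaps are nonnegative for real-valued u.  Cutting the sum at N leaves the
    boundary term |u(N)|^p (1 - ratio), which is nonnegative because g is
    increasing; thus every partial sum of the weighted sum is bounded by a
    partial sum of the form, and the inequality follows without truncating u.

    Positivity of w_(p,alpha) is strict concavity of n^c for 0 < c < 1; both
    exponents equal 1 only for (p, alpha) = (2, 1).

    For criticality one approximates g itself, whose gaps vanish since D(1,1) = 0.
    As D(s,t) + D(t,s) = (s - t)(s^(p-1) - t^(p-1)), a cutoff phi = psi^q costs at
    most C (psi(n) - psi(n+1))^2 times the edge weight, provided q >= 1 and
    q (p-1) >= 1; q = 1/a_p works for every p and avoids the singularity of
    powers at 0 (edge_energy_powR_le).  The edge weight is at most 2 (n+1)^(bp),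
    hence at most 2 (n+1) when alpha <= 1/(a_p + 1).  With respect to the edge
    weights n+1 the half-line is recurrent because the harmonic series diverges,
    so cutoffs of arbitrarily small energy exist (log_cutoff).  Testing with
    g phi shows that a Hardy weight above w_(p,alpha) cannot exceed it at any
    point (critical_of_null_sequence, power_null_sequence). *)

(** * Bernoulli inequalities and concavity of powers *)

(** For y = exp z, after division by exp (c z), the claim is that the convex
    combination c exp((1-c) z) + (1-c) exp(-c z) exceeds 1, which follows from
    exp r > 1 + r because the linear terms cancel. *)
Lemma powR_bernoulli_lt (R : realType) (c y : R) :
  0 < c < 1 -> 0 <= y -> y != 1 -> y `^ c < 1 + c * (y - 1).
Proof.
move=> /andP[c0 c1]; rewrite le_eqVlt => /predU1P[<- _|y0 y1].
  rewrite powR0 ?gt_eqF//; lra.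
have z0 : ln y != 0 by rewrite ln_eq0.
rewrite -[y]lnK ?posrE// /powR ?gt_eqF ?expR_gt0// expRK.
set z := ln y in z0 *.
have e1 : 1 + (1 - c) * z < expR ((1 - c) * z).
  by rewrite expR_gt1Dx// mulf_neq0// gt_eqF// subr_gt0.
have e2 : 1 + - c * z < expR (- c * z).
  by rewrite expR_gt1Dx// mulf_neq0// lt_eqF// oppr_lt0.
have -> : expR z = expR (c * z) * expR ((1 - c) * z).
  by rewrite -expRD; congr expR; ring.
have e3 : expR (c * z) * expR (- c * z) = 1.
  by rewrite -expRD -[RHS]expR0; congr expR; ring.
have e0 := expR_gt0 (c * z).
rewrite -subr_gt0.
have -> : 1 + c * (expR (c * z) * expR ((1 - c) * z) - 1) - expR (c * z) =
  expR (c * z) * (c * expR ((1 - c) * z) + (1 - c) * expR (- c * z) - 1).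
  transitivity (c * (expR (c * z) * expR ((1 - c) * z)) +
     (1 - c) * (expR (c * z) * expR (- c * z)) - expR (c * z)); last by ring.
  by rewrite e3; ring.
by rewrite mulr_gt0//; nra.
Qed.

Lemma powR_bernoulli (R : realType) (c y : R) :
  0 < c <= 1 -> 0 <= y -> y `^ c <= 1 + c * (y - 1).
Proof.
move=> /andP[c0]; rewrite le_eqVlt => /predU1P[-> y0|c1 y0].
  by rewrite powRr1//; lra.
have [->|y1] := eqVneq y 1; first by rewrite powR1; lra.
by apply/ltW/powR_bernoulli_lt; rewrite ?c0.
Qed.

(** Bernoulli's inequality for the exponent 1/q at (t/s)^q gives
    1 - (t/s)^q <= q (1 - t/s), and s^q <= s. *)
Lemma powR_sub_le (R : realType) (q s t : R) : 1 <= q -> 0 <= t <= s -> s <= 1 ->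
  s `^ q - t `^ q <= q * (s - t).
Proof.
move=> q1 /andP[t0 ts] s1.
have q0 : 0 < q by lra.
have [s0|s0] := eqVneq s 0.
  have -> : t = s by lra.
  by rewrite !subrr mulr0.
have {}s0 : 0 < s by rewrite lt0r s0 (le_trans t0).
have r0 : 0 <= t / s by rewrite divr_ge0// ltW.
have := @powR_bernoulli R q^-1 ((t / s) `^ q).
rewrite invr_gt0 q0 invf_le1// q1 powR_ge0 => /(_ isT isT).
rewrite -powRrM mulfV ?gt_eqF// powRr1// => h.
have h1 : 1 - (t / s) `^ q <= q * (1 - t / s).
  rewrite -(ler_pM2l (_ : 0 < q^-1)) ?invr_gt0// mulrA mulVf ?gt_eqF//; lra.
have h2 : s `^ q <= s by rewrite ge1r_powR// s0.
have h3 : s `^ q * (t / s) `^ q = t `^ q.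
  by rewrite -powRM// ?(ltW s0)//; congr (_ `^ _); field; rewrite gt_eqF.
have h4 : 0 <= q * (1 - t / s).
  by rewrite mulr_ge0 ?(ltW q0)// subr_ge0 ler_pdivrMr// mul1r.
have -> : s `^ q - t `^ q = s `^ q * (1 - (t / s) `^ q) by rewrite -h3; ring.
apply: (le_trans (ler_wpM2l (powR_ge0 s q) h1)).
apply: (le_trans (ler_wpM2r h4 h2)).
by rewrite le_eqVlt; apply/orP; left; apply/eqP; field; rewrite gt_eqF.
Qed.

Lemma dlaplacian_powerE (R : realType) (c : R) (n : nat) : (0 < n)%N ->
  dlaplacian (power_fun c) n =
  power_fun c n * (2 - (1 - n%:R^-1) `^ c - (1 + n%:R^-1) `^ c).
Proof.
move=> n0; have n0' : 0 < n%:R :> R by rewrite ltr0n.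
have i0 : 0 < n%:R^-1 :> R by rewrite invr_gt0.
have i1 : n%:R^-1 <= 1 :> R by rewrite invf_le1 ?ler1n.
rewrite /dlaplacian /power_fun.
have -> : n.-1%:R = n%:R * (1 - n%:R^-1) :> R.
  by case: n n0 n0' {i0 i1} => // n _ n0' /=; rewrite -natr1; field; rewrite natr1 gt_eqF.
have -> : n.+1%:R = n%:R * (1 + n%:R^-1) :> R.
  by rewrite -natr1; field; rewrite gt_eqF.
by rewrite !powRM ?ler0n//; try lra; ring.
Qed.

(** The two Bernoulli bounds, at 1 - 1/n and 1 + 1/n, have opposite linear
    terms; hence concave powers are superharmonic. *)
Lemma dlaplacian_power_ge0 (R : realType) (c : R) (n : nat) :
  0 < c <= 1 -> (0 < n)%N -> 0 <= dlaplacian (power_fun c) n.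
Proof.
move=> c01 n0; rewrite dlaplacian_powerE// mulr_ge0 ?powR_ge0//.
have i0 : 0 < n%:R^-1 :> R by rewrite invr_gt0 ltr0n.
have i1 : n%:R^-1 <= 1 :> R by rewrite invf_le1 ?ltr0n ?ler1n.
have := @powR_bernoulli R c (1 - n%:R^-1) c01 ltac:(lra).
have := @powR_bernoulli R c (1 + n%:R^-1) c01 ltac:(lra).
lra.
Qed.

Lemma dlaplacian_power_gt0 (R : realType) (c : R) (n : nat) :
  0 < c < 1 -> (0 < n)%N -> 0 < dlaplacian (power_fun c) n.
Proof.
move=> c01 n0; rewrite dlaplacian_powerE// mulr_gt0 ?powR_gt0 ?ltr0n//.
have i0 : 0 < n%:R^-1 :> R by rewrite invr_gt0 ltr0n.
have i1 : n%:R^-1 <= 1 :> R by rewrite invf_le1 ?ltr0n ?ler1n.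
have := @powR_bernoulli_lt R c (1 - n%:R^-1) c01 ltac:(lra) ltac:(lra).
have := @powR_bernoulli_lt R c (1 + n%:R^-1) c01 ltac:(lra) ltac:(lra).
lra.
Qed.

(** * Energy and gap of a single edge *)

Definition edge_energy {R : realType} (p a b : R) : R :=
  (a - b) * (spow a (p - 1) - spow b (p - 1)).

(** The contribution of a neighbour carrying the value y to the weight at a
    vertex where the ground state has the value x. *)
Definition edge_ratio {R : realType} (p x y : R) : R :=
  p^-1 * (y / x) `^ (p - 1) + (1 - p^-1) * (y / x).

(** Each end of the edge receives half of the diagonal coefficient 2 of the
    Laplacian, whence the 1 in front of each ratio. *)
Definition edge_gap {R : realType} (p x y a b : R) : R :=
  edge_energy p a b - `|a| `^ p * (1 - edge_ratio p x y)
                    - `|b| `^ p * (1 - edge_ratio p y x).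

(** The defect in Young's inequality for s and t^(p-1). *)
Definition young_gap {R : realType} (p s t : R) : R :=
  p^-1 * s `^ p + (1 - p^-1) * t `^ p - s * t `^ (p - 1).

Section Edge.
Context {R : realType} (p : R).
Hypothesis p1 : 1 < p.

Let p0 : 0 < p. Proof. exact: lt_trans p1. Qed.

Lemma spow_ge0E (a : R) : 0 <= a -> spow a (p - 1) = a `^ (p - 1).
Proof.
rewrite /spow le_eqVlt => /predU1P[<-|a0].
  by rewrite sgr0 mulr0 powR0// gt_eqF// subr_gt0.
by rewrite gtr0_norm// gtr0_sg// mulr1.
Qed.

Lemma young_gap_ge0 (s t : R) : 0 <= s -> 0 <= t -> 0 <= young_gap p s t.
Proof.
move=> s0 t0; rewrite /young_gap subr_ge0.
have d0 : 0 < p - 1 by rewrite subr_gt0.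
have := @conjugate_powR R s (t `^ (p - 1)) p (p / (p - 1)) s0 (powR_ge0 _ _) p0.
have -> : (p / (p - 1))^-1 = 1 - p^-1 by field; rewrite !gt_eqF.
rewrite divr_gt0// -powRrM.
have -> : (p - 1) * (p / (p - 1)) = p by field; rewrite gt_eqF.
by move=> /(_ isT); rewrite [s `^ p / p]mulrC [t `^ p * _]mulrC; apply; ring.
Qed.

Lemma young_gapD (s t : R) : 0 <= s -> 0 <= t ->
  young_gap p s t + young_gap p t s = edge_energy p s t.
Proof.
move=> s0 t0; rewrite /young_gap /edge_energy !spow_ge0E//.
by rewrite -(mulr_powRB1 s0 p0) -(mulr_powRB1 t0 p0); ring.
Qed.

(** Multiplying out, the cross terms of the energy are -x y^(p-1) s t^(p-1) and
    -x^(p-1) y t s^(p-1); the ratios distribute the matching powers of s and t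
    between the two Young defects. *)
Lemma edge_gapE (x y s t : R) : 0 < x -> 0 < y -> 0 <= s -> 0 <= t ->
  edge_gap p x y (x * s) (y * t) =
  x * y `^ (p - 1) * young_gap p s t + x `^ (p - 1) * y * young_gap p t s.
Proof.
move=> x0 y0 s0 t0.
have [x0' y0'] := (ltW x0, ltW y0).
rewrite /edge_gap /edge_energy /young_gap /edge_ratio.
rewrite !spow_ge0E ?mulr_ge0// !ger0_norm ?mulr_ge0//.
have divE a b : 0 < a -> 0 < b -> (a / b) `^ (p - 1) = a `^ (p - 1) / b `^ (p - 1).
  move=> a0 b0; apply: (canRL (mulfK _)); first by rewrite gt_eqF// powR_gt0.
  by rewrite -powRM ?divr_ge0 ?(ltW a0) ?(ltW b0)// divfK// gt_eqF.
rewrite !divE// !powRM// -!(mulr_powRB1 _ p0)//.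
have := powR_gt0 (p - 1) x0; have := powR_gt0 (p - 1) y0.
move=> ? ?; field; by rewrite !gt_eqF.
Qed.

Lemma edge_energy_norm (a b : R) : edge_energy p `|a| `|b| <= edge_energy p a b.
Proof.
rewrite /edge_energy (spow_ge0E `|a|)// (spow_ge0E `|b|)// /spow.
have key c d : c * (`|d| `^ (p - 1) * Num.sg d) <= `|c| * `|d| `^ (p - 1).
  rewrite (le_trans (ler_norm _))// !normrM (ger0_norm (powR_ge0 _ _)).
  rewrite normr_sg ler_wpM2l// -[leRHS]mulr1 ler_wpM2l ?powR_ge0//.
  by rewrite lern1; case: (d != 0).
have self c : c * (`|c| `^ (p - 1) * Num.sg c) = `|c| * `|c| `^ (p - 1).
  by set P := _ `^ _; rewrite normrEsg; ring.
have := key a b; have := key b a; have := self a; have := self b.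
rewrite !(mulrBl, mulrBr); lra.
Qed.

(** Signs only help: the gap depends on them through the energy alone, and at
    nonnegative values it is a combination of Young defects. *)
Lemma edge_gap_ge0 (x y a b : R) : 0 < x -> 0 < y -> 0 <= edge_gap p x y a b.
Proof.
move=> x0 y0.
have h : 0 <= edge_gap p x y `|a| `|b|.
  have -> : `|a| = x * (`|a| / x) by rewrite mulrC divfK// gt_eqF.
  have -> : `|b| = y * (`|b| / y) by rewrite mulrC divfK// gt_eqF.
  have ? : 0 <= `|a| / x by rewrite divr_ge0// ltW.
  have ? : 0 <= `|b| / y by rewrite divr_ge0// ltW.
  by rewrite edge_gapE// addr_ge0// mulr_ge0 ?young_gap_ge0// mulr_ge0 ?powR_ge0 ?ltW.
apply: (le_trans h); rewrite /edge_gap !normr_id.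
have := edge_energy_norm a b; lra.
Qed.

(** Each Young defect is bounded by the sum of the two, which is the energy of
    the edge for the constant ground state. *)
Lemma edge_gap_le (x y s t : R) : 0 < x -> 0 < y -> 0 <= s -> 0 <= t ->
  edge_gap p x y (x * s) (y * t) <=
  (x * y `^ (p - 1) + x `^ (p - 1) * y) * edge_energy p s t.
Proof.
move=> x0 y0 s0 t0; rewrite edge_gapE// -young_gapD//.
have := young_gap_ge0 _ _ s0 t0; have := young_gap_ge0 _ _ t0 s0.
have : 0 <= x * y `^ (p - 1) by rewrite mulr_ge0 ?powR_ge0 ?ltW.
have : 0 <= x `^ (p - 1) * y by rewrite mulr_ge0 ?powR_ge0 ?ltW.
move: (x * _) (_ * y) (young_gap _ _ _) (young_gap _ _ _) => A B C D *; nra.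
Qed.

Lemma edge_energy_ge0 (a b : R) : 0 <= edge_energy p a b.
Proof.
apply: le_trans (edge_energy_norm a b).
by rewrite -young_gapD// addr_ge0// young_gap_ge0.
Qed.

End Edge.

(** * Ground state representation and the Hardy inequality *)

Definition ground_state_weight {R : realType} (p : R) (g : nat -> R) (n : nat) : R :=
  2 - edge_ratio p (g n) (g n.-1) - edge_ratio p (g n) (g n.+1).

(** The vertex N+1 has so far received only its left edge, so it enters with the
    half coefficient 1 - ratio in place of the weight. *)
Lemma ground_state_split {R : realType} (p : R) (g u : nat -> R) (N : nat) :
  1 < p -> g 0%N = 0 -> u 0%N = 0 ->
  \sum_(1 <= n < N.+2) edge_energy p (u n) (u n.-1) =
  \sum_(1 <= n < N.+1) ground_state_weight p g n * `|u n| `^ p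
  + `|u N.+1| `^ p * (1 - edge_ratio p (g N.+1) (g N))
  + \sum_(1 <= n < N.+1) edge_gap p (g n.+1) (g n) (u n.+1) (u n).
Proof.
move=> p1 g0 u0; elim: N => [|N IH].
  (* On the edge {0,1} both u and g vanish at 0: the ratio is 0 and the energy
     is |u(1)|^p. *)
  have d0 : p - 1 != 0 by rewrite gt_eqF// subr_gt0.
  rewrite big_nat1 !big_geq// g0 u0 /edge_energy /edge_ratio mul0r powR0//.
  rewrite {2}/spow sgr0 /spow subr0 mulr0 !subr0 add0r addr0.
  rewrite -(@mulr_powRB1 _ `|u 1%N| p)//; last by lra.
  by set P := _ `^ (p - 1); rewrite normrEsg; ring.
rewrite big_nat_recr//= IH.
rewrite [\sum_(1 <= n < N.+2) ground_state_weight _ _ _ * _]big_nat_recr//=.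
rewrite [\sum_(1 <= n < N.+2) edge_gap _ _ _ _ _]big_nat_recr//=.
by rewrite /edge_gap /ground_state_weight /=; ring.
Qed.

(** Monotonicity of g makes the boundary term nonnegative, since the ratio
    towards the left is then a convex combination of numbers at most 1. *)
Lemma sum_ground_state_weight_le {R : realType} (p : R) (g u : nat -> R) (N : nat) :
  1 < p -> (forall n, (0 < n)%N -> 0 < g n) -> {homo g : m n / (m <= n)%N >-> m <= n} ->
  g 0%N = 0 -> u 0%N = 0 ->
  \sum_(1 <= n < N.+1) ground_state_weight p g n * `|u n| `^ p <=
  \sum_(1 <= n < N.+2) edge_energy p (u n) (u n.-1).
Proof.
move=> p1 gpos gmono g0 u0; rewrite (@ground_state_split _ _ g)// -addrA lerDl addr_ge0//.
  rewrite mulr_ge0 ?powR_ge0// subr_ge0 /edge_ratio.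
  have gN : 0 < g N.+1 by exact: gpos.
  have gN0 : 0 <= g N by rewrite -g0 gmono.
  have r0 : 0 <= g N / g N.+1 by rewrite divr_ge0// ltW.
  have r1 : g N / g N.+1 <= 1 by rewrite ler_pdivrMr// mul1r gmono.
  have s1 : (g N / g N.+1) `^ (p - 1) <= 1.
    have := @ge0_ler_powR R (p - 1) ltac:(lra) (g N / g N.+1) 1.
    by rewrite powR1; apply; rewrite ?nnegrE.
  have ip0 : 0 < p^-1 by rewrite invr_gt0; lra.
  have ip1 : p^-1 <= 1 by rewrite invf_le1; lra.
  nra.
rewrite big_nat_cond sumr_ge0// => n; rewrite andbT => /andP[n0 _].
by rewrite edge_gap_ge0// gpos.
Qed.

Lemma weighted_sum_le_sobolev_bregman {R : realType} (p : R) (g u : nat -> R) :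
  1 < p -> (forall n, (0 < n)%N -> 0 < g n) -> {homo g : m n / (m <= n)%N >-> m <= n} ->
  g 0%N = 0 -> (forall n, (0 < n)%N -> 0 <= ground_state_weight p g n) ->
  u 0%N = 0 ->
  (weighted_sum p (ground_state_weight p g) u <= sobolev_bregman p u)%E.
Proof.
move=> p1 gpos gmono g0 w0 u0.
have term0 n : (0 < n)%N -> 0 <= ground_state_weight p g n * `|u n| `^ p.
  by move=> n0; rewrite mulr_ge0 ?powR_ge0 ?w0.
rewrite /weighted_sum; apply: lime_le.
  by apply: is_cvg_nneseries => n n1 _; rewrite lee_fin term0.
apply: nearW => -[|N]; first by rewrite big_geq// nneseries_ge0// => n _ _;
  rewrite lee_fin edge_energy_ge0.
rewrite sumEFin.
apply: (@le_trans _ _ (\sum_(1 <= n < N.+2) edge_energy p (u n) (u n.-1))%:E).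
  by rewrite lee_fin sum_ground_state_weight_le.
rewrite -sumEFin; apply: nneseries_lim_ge => n _ _.
by rewrite lee_fin edge_energy_ge0.
Qed.

(** * Null sequences and criticality *)

Lemma nneseries_finite {R : realType} (f : nat -> R) (N : nat) :
  (forall n, (N < n)%N -> f n = 0) ->
  (\sum_(1 <= n <oo) (f n)%:E = (\sum_(1 <= n < N.+1) f n)%:E)%E.
Proof.
move=> f0; apply: cvg_lim => //.
apply: cvg_near_cst.
exists N.+1 => // n /= Nn.
rewrite sumEFin; congr EFin.
rewrite (big_cat_nat _ Nn)//= [X in _ + X](_ : _ = 0) ?addr0//.
by rewrite big_nat big1// => i /andP[Ni _]; rewrite f0.
Qed.

(** If w'(m) > w(m), the Hardy inequality for w' and the smallness of
    E(u) - sum w |u|^p give (w'(m) - w(m)) c <= eps for every eps. *)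
Lemma critical_of_null_sequence {R : realType} (p : R) (w : nat -> R) :
  hardy_weight p w ->
  (forall m, (0 < m)%N -> exists2 c : R, 0 < c & forall eps : R, 0 < eps ->
    exists u : nat -> R, exists N : nat,
    [/\ u 0%N = 0, (forall n, (N < n)%N -> u n = 0), c <= `|u m| `^ p &
     \sum_(1 <= n < N.+2) edge_energy p (u n) (u n.-1)
       <= \sum_(1 <= n < N.+1) w n * `|u n| `^ p + eps]) ->
  1 < p -> critical_hardy_weight p w.
Proof.
move=> hw null p1; split=> // w' [_ hw'] ww' m m0.
have p0 : p != 0 by rewrite gt_eqF//; lra.
apply/eqP; rewrite eq_le ww'// andbT leNgt; apply/negP => lt.
have [c c0 /(_ ((w' m - w m) * c / 2))] := null m m0.
rewrite divr_gt0// ?mulr_gt0 ?subr_gt0// => /(_ isT)[u [N [u0 uN cu le]]].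
have mN : (m <= N)%N.
  by rewrite leqNgt; apply/negP => /uN um; move: cu; rewrite um normr0 powR0// leNgt c0.
have fu : finitely_supported u.
  apply: (@sub_finite_set _ _ `I_N.+1); last exact: finite_II.
  by move=> n /= /eqP un; rewrite ltnS leqNgt; apply/negP => /uN.
have := hw' u u0 fu.
rewrite /weighted_sum (@nneseries_finite _ _ N); last first.
  by move=> n /uN->; rewrite normr0 powR0// mulr0.
rewrite /sobolev_bregman (@nneseries_finite _ _ N.+1); last first.
  move=> [//|n] Nn /=; rewrite uN ?uN// ?subrr ?mul0r//; exact: ltnW.
rewrite lee_fin => le'.
have {le le'} := le_trans le' le.
rewrite leNgt => /negP; apply.
rewrite -ltrBrDl -sumrB.
rewrite (bigD1_seq m) ?mem_index_iota ?iota_uniq ?m0//=.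
rewrite ltr_wpDr//.
  rewrite big_nat_cond sumr_ge0// => n /andP[/andP[n0 _] _].
  by rewrite -mulrBl mulr_ge0 ?powR_ge0// subr_ge0 ww'.
rewrite -mulrBl; move: lt; rewrite -subr_gt0; nra.
Qed.

Lemma harmonic_sum_unbounded {R : realType} (m : nat) (A : R) :
  exists2 N, (m <= N)%N & A < \sum_(m <= j < N) j.+1%:R^-1.
Proof.
apply: contrapT => h; apply: (@dvg_harmonic R).
have hb N : \sum_(0 <= j < N) harmonic j <= \sum_(0 <= j < m) harmonic j + Num.max A 0.
  have h0 a b : 0 <= \sum_(a <= j < b) harmonic j :> R.
    by rewrite sumr_ge0// => j _; exact: harmonic_ge0.
  have [mN|/ltnW Nm] := leqP m N.
    rewrite (big_cat_nat _ mN)//= lerD2l le_max leNgt; apply/orP; left.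
    by apply/negP => hA; apply: h; exists N.
  by rewrite [in leRHS](big_cat_nat _ Nm)//= -addrA lerDl addr_ge0// le_max lexx orbT.
apply: nondecreasing_is_cvgn.
  apply/nondecreasing_seqP => n; rewrite seriesEnat/= big_nat_recr//= lerDl.
  exact: harmonic_ge0.
by exists (\sum_(0 <= j < m) harmonic j + Num.max A 0) => _ [n _ <-]; rewrite seriesEnat; exact: hb.
Qed.

(** Optimal cutoffs for the edge weights n+1 have decrements proportional to the
    resistances 1/(n+1).  They are 1 up to m and vanish from N on, and their
    energy is the inverse of the resistance between m and N, which is arbitrarily
    small because the harmonic series diverges. *)
Lemma log_cutoff {R : realType} (m : nat) (eps : R) : 0 < eps ->
  exists psi : nat -> R, exists N : nat,
  [/\ (forall n, 0 <= psi n.+1 <= psi n), psi 0%N <= 1, psi m = 1,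
      (forall n, (N < n)%N -> psi n = 0) &
      \sum_(1 <= n < N.+1) n.+1%:R * (psi n - psi n.+1) ^+ 2 <= eps].
Proof.
move=> eps0; have [N mN] := @harmonic_sum_unbounded R m eps^-1.
set H := \sum_(m <= j < N) _ => HN.
have H0 : 0 < H by apply: lt_trans HN; rewrite invr_gt0.
pose d (j : nat) : R := if (m <= j < N)%N then j.+1%:R^-1 / H else 0.
have d0 j : 0 <= d j.
  by rewrite /d; case: ifP => // _; rewrite divr_ge0 ?invr_ge0 ?ler0n ?(ltW H0).
pose psi (n : nat) : R := \sum_(n <= j < N) d j.
have psi0 n : 0 <= psi n by rewrite sumr_ge0.
have psiB n : psi n - psi n.+1 = d n.
  have [nN|Nn] := ltnP n N; first by rewrite /psi big_ltn// addrK.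
  by rewrite /psi !big_geq ?(leqW Nn)// subrr /d [(n < N)%N]ltnNge Nn andbF.
have psim : psi m = 1.
  rewrite /psi (eq_big_nat _ _ (F2 := fun j => j.+1%:R^-1 / H)).
    by rewrite -mulr_suml divff// gt_eqF.
  by move=> j mjN; rewrite /d mjN.
have psi00 : psi 0%N = 1.
  rewrite -psim /psi (big_cat_nat _ mN)//= [X in X + _](_ : _ = 0) ?add0r//.
  by rewrite big_nat big1// => j /andP[_ jm]; rewrite /d leqNgt jm.
exists psi, N; split => //.
- by move=> n; rewrite psi0 /= -subr_ge0 psiB.
- by rewrite psi00.
- by move=> n Nn; rewrite /psi big_geq// ltnW.
apply: (@le_trans _ _ H^-1); last by rewrite -[leRHS]invrK lef_pV2 ?posrE ?invr_gt0// ltW.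
(* Both factors of the square carry 1/(n+1), one of which cancels the edge
   weight; what is left sums to the total decrement divided by H. *)
have dE n : n.+1%:R * (psi n - psi n.+1) ^+ 2 = H^-1 * d n.
  rewrite psiB /d; case: ifP => _; last by rewrite expr0n/= !mulr0.
  by field; rewrite gt_eqF//= natr1 pnatr_eq0.
rewrite (eq_bigr _ (fun n _ => dE n)) -mulr_sumr -[leRHS]mulr1 ler_wpM2l//.
  by rewrite invr_ge0 ltW.
rewrite -psi00 /psi.
have [->|N0] := posnP N; first by rewrite !big_geq.
rewrite big_nat_recr//= [d N](_ : _ = 0); last by rewrite /d ltnn andbF.
by rewrite addr0 [leRHS]big_ltn// lerDr.
Qed.

(** Both s^q and (s^q)^(p-1) = s^(q(p-1)) are Lipschitz on [0, 1], as the two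
    exponents are at least 1. *)
Lemma edge_energy_powR_le {R : realType} (p q s t : R) : 1 < p -> 1 <= q ->
  1 <= q * (p - 1) -> 0 <= s <= t -> t <= 1 ->
  edge_energy p (s `^ q) (t `^ q) <= q * (q * (p - 1)) * (t - s) ^+ 2.
Proof.
move=> p1 q1 qp1 /andP[s0 st] t1.
have st0 : 0 <= s <= t by rewrite s0.
have t0 : 0 <= t by exact: le_trans st.
rewrite /edge_energy !spow_ge0E ?powR_ge0// -!powRrM -mulrNN !opprB expr2 mulrACA.
have mono r : 1 <= r -> 0 <= t `^ r - s `^ r.
  by move=> r1; rewrite subr_ge0 ge0_ler_powR ?nnegrE//; lra.
by rewrite ler_pM ?mono ?powR_sub_le.
Qed.

(** * Powers as ground states *)

Lemma power_fun0 {R : realType} (b : R) : 0 < b -> power_fun b 0 = 0.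
Proof. by move=> b0; rewrite /power_fun powR0// gt_eqF. Qed.

Lemma power_fun_gt0 {R : realType} (b : R) (n : nat) : (0 < n)%N -> 0 < power_fun b n.
Proof. by move=> n0; rewrite powR_gt0// ltr0n. Qed.

Lemma power_fun_homo {R : realType} (b : R) : 0 < b ->
  {homo power_fun b : m n / (m <= n)%N >-> m <= n}.
Proof.
by move=> b0 m n mn; rewrite /power_fun ge0_ler_powR ?nnegrE ?ler_nat// ltW.
Qed.

Lemma ground_state_weight_power {R : realType} (p b : R) (n : nat) : (0 < n)%N ->
  ground_state_weight p (power_fun b) n =
  p^-1 * (dlaplacian (power_fun (b * (p - 1))) n / power_fun (b * (p - 1)) n)
  + (1 - p^-1) * (dlaplacian (power_fun b) n / power_fun b n).
Proof.
move=> n0; have nb (c : R) := power_fun_gt0 c _ n0.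
have ratioE k : edge_ratio p (power_fun b n) (power_fun b k) =
    p^-1 * (power_fun (b * (p - 1)) k / power_fun (b * (p - 1)) n)
    + (1 - p^-1) * (power_fun b k / power_fun b n).
  rewrite /edge_ratio /power_fun; congr (_ * _ + _); rewrite !powRrM.
  apply: (canRL (mulfK _)); first by rewrite gt_eqF// !powR_gt0// ltr0n.
  by rewrite -powRM ?divr_ge0 ?powR_ge0// divfK// gt_eqF// nb.
rewrite /ground_state_weight !ratioE /dlaplacian.
have := nb b; have := nb (b * (p - 1)).
move: (power_fun b n) (power_fun _ n) p^-1 => x y c y0 x0.
by field; rewrite !gt_eqF.
Qed.

Lemma conj_exp_subr1 {R : realType} (p : R) : 1 < p -> conj_exp p - 1 = (p - 1)^-1.
Proof. by move=> p1; rewrite /conj_exp; field; rewrite gt_eqF// subr_gt0. Qed.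

Lemma a_bounds {R : realType} (p : R) : 1 < p -> [/\ 0 < a_ p, a_ p <= 1 & a_ p <= p - 1].
Proof.
move=> p1; have d0 : 0 < p - 1 by lra.
rewrite /a_ conj_exp_subr1//; split.
- by rewrite lt_min d0 invr_gt0.
- rewrite ge_min; have [//|/ltW h] := leP (p - 1) 1.
  by rewrite invf_le1// h orbT.
- by rewrite ge_min lexx.
Qed.

(** For p <= 2 one has a_p = p - 1 and 1/(a_p + 1) = 1/p; for p >= 2 one has
    a_p = 1/(p-1) and 1/(a_p + 1) = 1 - 1/p, so that the two summands of the
    weight are exchanged. *)
Lemma w_ground_state {R : realType} (p alpha : R) : 1 < p -> 0 < alpha ->
  exists b : R, [/\ 0 < b, b * p = alpha * (a_ p + 1) &
    forall n, (0 < n)%N -> w_ p alpha n = ground_state_weight p (power_fun b) n].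
Proof.
move=> p1 al0; have d0 : 0 < p - 1 by lra.
have p0 : 0 < p by lra.
have [le|/ltW le] := leP (p - 1) (conj_exp p - 1).
- have aE : a_ p = p - 1 by rewrite /a_ (min_l le).
  exists alpha; split => //; first by rewrite aE subrK.
  move=> n n0; rewrite ground_state_weight_power// /w_ aE subrK div1r.
  by congr (_ + _ * _); field; rewrite gt_eqF.
- have aE : a_ p = (p - 1)^-1 by rewrite /a_ (min_r le) conj_exp_subr1.
  exists (alpha * (p - 1)^-1); split; first by rewrite mulr_gt0 ?invr_gt0.
    by rewrite aE; field; rewrite gt_eqF.
  move=> n n0; rewrite ground_state_weight_power// /w_ aE addrC mulfVK ?gt_eqF//.
  congr (_ * _ + _ * _); field; rewrite !gt_eqF//; lra.
Qed.

(** At least one of the exponents alpha and alpha * a_p is below 1, as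
    alpha = a_p = 1 forces p = 2. *)
Lemma w_gt0 {R : realType} (p alpha : R) (n : nat) : 1 < p -> 0 < alpha -> alpha <= 1 ->
  (p, alpha) <> (2, 1) -> (0 < n)%N -> 0 < w_ p alpha n.
Proof.
move=> p1 al0 al1 ne n0; have [a0 a1 ap] := a_bounds _ p1.
rewrite /w_.
have g0 c : 0 < power_fun c n :> R by exact: power_fun_gt0.
have c1 : 0 < 1 / (a_ p + 1) by rewrite divr_gt0// addr_gt0.
have c2 : 0 < a_ p / (a_ p + 1) by rewrite divr_gt0// addr_gt0.
have aa1 : alpha * a_ p <= 1 by nra.
have aa0 : 0 < alpha * a_ p by rewrite mulr_gt0.
have ge0 (c : R) : 0 < c <= 1 -> 0 <= dlaplacian (power_fun c) n / power_fun c n.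
  by move=> c01; rewrite divr_ge0 ?dlaplacian_power_ge0// ltW.
have gt0 (c : R) : 0 < c < 1 -> 0 < dlaplacian (power_fun c) n / power_fun c n.
  by move=> c01; rewrite divr_gt0 ?dlaplacian_power_gt0.
have [al1'|al1'] := ltP alpha 1.
  by apply: ltr_wpDl; [apply: (mulr_ge0 (ltW c1)); apply: ge0; rewrite aa0|
    apply: (mulr_gt0 c2); apply: gt0; rewrite al0].
have ale : alpha = 1 by apply/eqP; rewrite eq_le al1.
have a1' : a_ p < 1.
  rewrite lt_neqAle a1 andbT; apply/eqP => ae; apply: ne; rewrite ale; congr pair.
  have d0 : 0 < p - 1 by lra.
  have : 1 <= (p - 1)^-1 by rewrite -[X in X <= _]ae -conj_exp_subr1// /a_ ge_min lexx orbT.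
  rewrite -[X in X <= _]invr1 lef_pV2 ?posrE// => h; lra.
apply: ltr_wpDr; first by apply: (mulr_ge0 (ltW c2)); apply: ge0; rewrite al0.
by apply: (mulr_gt0 c1); apply: gt0; rewrite aa0 ale mul1r.
Qed.

(** The condition b p <= 1 keeps the edge weights x y^(p-1) and x^(p-1) y, for
    x = (n+1)^b and y = n^b, at most n + 1, the borderline growth at which
    cutoffs of small energy still exist. *)
Lemma power_null_sequence {R : realType} (p b : R) (m : nat) (eps : R) :
  1 < p -> 0 < b -> b * p <= 1 -> 0 < eps ->
  exists u : nat -> R, exists N : nat,
  [/\ u 0%N = 0, (forall n, (N < n)%N -> u n = 0), u m = power_fun b m &
     \sum_(1 <= n < N.+2) edge_energy p (u n) (u n.-1)
       <= \sum_(1 <= n < N.+1) ground_state_weight p (power_fun b) n * `|u n| `^ p + eps].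
Proof.
move=> p1 b0 bp1 eps0; have [a0 a1 ap] := a_bounds _ p1.
pose q := (a_ p)^-1.
have q1 : 1 <= q by rewrite invf_ge1.
have qp1 : 1 <= q * (p - 1) by rewrite mulrC ler_pdivlMr// mul1r.
pose C := 2 * (q * (q * (p - 1))).
have C0 : 0 < C by rewrite /C !mulr_gt0//; lra.
have [|psi [N [psi_dec psi01 psim psiN psiE]]] := @log_cutoff R m (eps / C).
  by rewrite divr_gt0.
have psi0 n : 0 <= psi n by have /andP[] := psi_dec n => h; exact: le_trans.
have psi1 n : psi n <= 1.
  by elim: n => // n IH; have /andP[_ h] := psi_dec n; exact: le_trans h IH.
pose u n := power_fun b n * psi n `^ q.
have q0 : q != 0 by rewrite gt_eqF//; lra.
have uN n : (N < n)%N -> u n = 0 by move=> /psiN h; rewrite /u h powR0// mulr0.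
have u0 : u 0%N = 0 by rewrite /u power_fun0// mul0r.
exists u, N; split => //; first by rewrite /u psim powR1 mulr1.
rewrite (@ground_state_split _ _ (power_fun b))// ?power_fun0//.
have p0 : p != 0 by rewrite gt_eqF//; lra.
rewrite (uN N.+1)// normr0 powR0// mul0r addr0 lerD2l.
have := ler_wpM2l (ltW C0) psiE; rewrite [C * (eps / C)]mulrC divfK ?gt_eqF//.
apply: le_trans; rewrite mulr_sumr.
rewrite big_nat [leRHS]big_nat; apply: ler_sum => n /andP[n0 _].
apply: le_trans.
  by apply: edge_gap_le => //; rewrite ?power_fun_gt0 ?powR_ge0.
have e1 := @edge_energy_powR_le R p q (psi n.+1) (psi n) p1 q1 qp1 (psi_dec n) (psi1 n).
have e0 := @edge_energy_ge0 R p p1 (psi n.+1 `^ q) (psi n `^ q).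
have n1 : 1 <= n.+1%:R :> R by rewrite ler1n.
have bd : power_fun b n.+1 * power_fun b n `^ (p - 1)
   + power_fun b n.+1 `^ (p - 1) * power_fun b n <= 2 * n.+1%:R :> R.
  have Xp : power_fun b n.+1 * power_fun b n.+1 `^ (p - 1) <= n.+1%:R :> R.
    rewrite mulr_powRB1 ?powR_ge0 -?powRrM//; last by lra.
    by rewrite ler1_powR.
  have YX := power_fun_homo b b0 _ _ (leqnSn n).
  have YX' : power_fun b n `^ (p - 1) <= power_fun b n.+1 `^ (p - 1).
    by rewrite ge0_ler_powR ?nnegrE ?powR_ge0//; lra.
  have X0 : 0 <= power_fun b n.+1 :> R by rewrite powR_ge0.
  have X0' : 0 <= power_fun b n.+1 `^ (p - 1) by rewrite powR_ge0.
  have := ler_wpM2l X0 YX'; have := ler_wpM2l X0' YX; lra.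
apply: (le_trans (ler_wpM2r e0 bd)).
apply: (le_trans (ler_wpM2l _ e1)); first by rewrite mulr_ge0.
by rewrite /C le_eqVlt; apply/orP; left; apply/eqP; ring.
Qed.

Theorem theorem1p1 (R : realType) (p alpha : R)
    (hp : 1 < p) (halpha0 : 0 < alpha) (halpha1 : alpha <= 1)
    (hne : (p, alpha) <> (2, 1)) :
  (forall u : nat -> R, u 0%N = 0 ->
     in_lp_weight p (fun x : nat => x%:R ^- 2) u ->
     (weighted_sum p (w_ p alpha) u <= sobolev_bregman p u)%E) /\
  hardy_weight p (w_ p alpha) /\
  (forall x : nat, (0 < x)%N -> 0 < w_ p alpha x) /\
  (alpha <= 1 / (a_ p + 1) -> critical_hardy_weight p (w_ p alpha)).
Proof.
have [b [b0 bp wE]] := w_ground_state p alpha hp halpha0.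
have wpos n : (0 < n)%N -> 0 < w_ p alpha n by exact: w_gt0.
have ineq u : u 0%N = 0 -> (weighted_sum p (w_ p alpha) u <= sobolev_bregman p u)%E.
  move=> u0.
  have -> : weighted_sum p (w_ p alpha) u =
      weighted_sum p (ground_state_weight p (power_fun b)) u.
    rewrite /weighted_sum; apply: congr_lim; apply/funext => n.
    by apply: eq_big_nat => i /andP[i0 _]; rewrite wE.
  apply: weighted_sum_le_sobolev_bregman => //.
  - exact: power_fun_gt0.
  - exact: power_fun_homo.
  - exact: power_fun0.
  - by move=> n n0; rewrite -wE// ltW// wpos.
have hw : hardy_weight p (w_ p alpha).
  by split=> [n n0|u u0 _]; [rewrite ltW// wpos|exact: ineq].
split=> [u u0 _|]; first exact: ineq.
split=> //; split=> // al.
apply: critical_of_null_sequence => // m m0.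
exists (power_fun b m `^ p); first by rewrite powR_gt0 ?power_fun_gt0.
move=> eps eps0.
have bp1 : b * p <= 1.
  have [a0 _ _] := a_bounds _ hp.
  by rewrite bp -ler_pdivlMr// addr_gt0.
have [u [N [u0 uN um le]]] := @power_null_sequence R p b m eps hp b0 bp1 eps0.
exists u, N; split => //; first by rewrite um ger0_norm ?powR_ge0.
apply: (le_trans le); rewrite lerD2r le_eqVlt; apply/orP; left; apply/eqP.
by apply: eq_big_nat => n /andP[n0 _]; rewrite wE.
Qed.
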